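(* Let $a \geq 1$ and $\alpha > 0$. Consider the scalar system $X_{n+1} = a X_n + Z_n - U_n$, $n = 1, 2, \ldots$, where $X_1, Z_1, Z_2, \ldots$ are independent real random variables with bounded $\alpha$-th moments, i.e. $\mathbb{E}[|X_1|^\alpha] < \infty$ and $\sup_n \mathbb{E}[|Z_n|^\alpha] < \infty$. Then for every $0 < \beta < \alpha$, $$M^\star_\beta \leq \lfloor a \rfloor + 1.$$
   Context: An $M$-bin causal quantizer-controller is a sequence $\{\mathsf f_n, \mathsf g_n\}_{n=1}^\infty$ of (measurable) maps $\mathsf f_n \colon \mathbb{R}^n \to [M] = \{1,\ldots,M\}$ and $\mathsf g_n \colon [M]^n \to \mathbb{R}$; the control at time $n$ is $U_n = \mathsf g_n(\mathsf f_1(X_1), \mathsf f_2(X_1,X_2), \ldots, \mathsf f_n(X_1,\ldots,X_n))$. For $\beta > 0$, $M^\star_\beta$ is the minimum $M$ such that there exists an $M$-bin causal quantizer-controller for which the resulting state process satisfies $\limsup_{n\to\infty} \mathbb{E}[|X_n|^\beta] < \infty$ ($\beta$-moment stability). *)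

(* Defs.v *)
From HB Require Import structures.
From mathcomp Require Import all_boot all_order all_algebra.
From mathcomp Require Import all_classical all_reals all_analysis.
Set Implicit Arguments. Unset Strict Implicit. Unset Printing Implicit Defensive.
Import Order.TTheory GRing.Theory Num.Theory.
Local Open Scope classical_set_scope.
Local Open Scope ring_scope.

Section Defs.
Context {R : realType}.

Definition Rn_boxes (n : nat) : set (set ('I_n -> R)) :=
  [set B | exists b : 'I_n -> R, B = [set x | forall i, x i <= b i]].
Arguments Rn_boxes : clear implicits.

Definition Rn_borel (n : nat) (A : set ('I_n -> R)) : Prop :=
  <<s Rn_boxes n >> A.
Arguments Rn_borel : clear implicits.

Definition Rn_measurable_quant (n M : nat) (f : ('I_n -> R) -> 'I_M) : Prop :=
  forall k : 'I_M, Rn_borel n (f @^-1` [set k]).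

Definition mutually_independent {d : measure_display} {T : measurableType d}
  (P : probability T R) (W : nat -> T -> R) : Prop :=
  forall (J : seq nat) (B : nat -> set R),
    uniq J -> (forall j, j \in J -> measurable (B j)) ->
    P (\bigcap_(j in [set j | j \in J]) (W j @^-1` B j)) =
    (\prod_(j <- J) P (W j @^-1` B j))%E.

(* ---- Closed-loop system (0-indexed: paper's time n+1 is index n). ---- *)
(* A causal quantizer-controller with M bins:
   f k : R^(k+1) -> [M] and g k : [M]^(k+1) -> R, k = 0,1,2,...          *)

Definition qcodes (M : nat) (f : forall k : nat, ('I_k.+1 -> R) -> 'I_M)
  (n : nat) (h : seq R) : 'I_n.+1 -> 'I_M :=
  fun j => f j (fun i : 'I_(nat_of_ord j).+1 => nth 0 h i).

Arguments qcodes {M} f n h.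

Definition control (M : nat) (f : forall k : nat, ('I_k.+1 -> R) -> 'I_M)
  (g : forall k : nat, ('I_k.+1 -> 'I_M) -> R) (n : nat) (h : seq R) : R :=
  g n (qcodes f n h).

Arguments control {M} f g n h.

Fixpoint traj (M : nat) (f : forall k : nat, ('I_k.+1 -> R) -> 'I_M)
  (g : forall k : nat, ('I_k.+1 -> 'I_M) -> R) (a : R) (X0 : R)
  (Z : nat -> R) (n : nat) : seq R :=
  match n with
  | 0 => [:: X0]
  | n'.+1 => let h := traj f g a X0 Z n' in
             rcons h (a * nth 0 h n' + Z n' - control f g n' h)
  end.

Arguments traj {M} f g a X0 Z n.

Definition state {T : Type} (M : nat) (f : forall k : nat, ('I_k.+1 -> R) -> 'I_M)
  (g : forall k : nat, ('I_k.+1 -> 'I_M) -> R) (a : R) (X0 : T -> R)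
  (Z : nat -> T -> R) (n : nat) (w : T) : R :=
  nth 0 (traj f g a (X0 w) (fun k => Z k w) n) n.

Arguments state {T M} f g a X0 Z n w.

Definition moment_stable {d : measure_display} {T : measurableType d}
  (P : probability T R) (beta : R) (X : nat -> T -> R) : Prop :=
  (limn_esup (fun n => \int[P]_w ((`|X n w| `^ beta)%:E)) < +oo)%E.

End Defs.

(* Main.v *)
(* With M = floor a + 1 > a bins, M ^ m / a ^ m is as large as we like, so we
   work in blocks of m steps: during a block the digits of one of N + 2 = M ^ m
   symbols describing the state y at its start are sent, and the control acts
   only on the last step. Symbols 0, ..., N index a uniform grid of [-D, D] and
   N + 1 signals overflow |y| > D; the scale D becomes max (D / 2) 1 in range
   and K * D on overflow, which both ends can track. For K large the function
     W = D ^ beta                                 if |y| <= D,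
     W = c * |y| ^ alpha * D ^ (beta - alpha)     otherwise
   dominates |y| ^ beta and satisfies, on every sample path,
     W' <= 2 ^ (- beta) * W + C * (1 + (block noise) ^ alpha),
   because the overshoot after a large noise z costs only a factor
   |z / D| ^ (alpha - beta) while zooming out. Taking expectations bounds
   E W, hence E |X_n| ^ beta, uniformly in n. *)
Require Import Defs.
From HB Require Import structures.
From mathcomp Require Import all_boot all_order all_algebra.
From mathcomp Require Import all_classical all_reals all_analysis.
From mathcomp Require Import measurable_realfun.
From mathcomp Require Import zify ring lra.
Import Order.TTheory GRing.Theory Num.Theory.
Local Open Scope classical_set_scope.
Local Open Scope ring_scope.

(** * Elementary inequalities for real powers *)

Section PowerInequalities.
Context {R : realType}.
Implicit Types (x y r s : R).

Lemma one_powR r : 1 `^ r = 1.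
Proof. by rewrite powR1. Qed.

Lemma le_powR_l r x y : 0 <= r -> 0 <= x -> x <= y -> x `^ r <= y `^ r.
Proof.
move=> r0 x0 xy; apply: ge0_ler_powR => //; rewrite nnegrE //.
exact: le_trans xy.
Qed.

Lemma powR_add_le r x y : 0 <= r -> 0 <= x -> 0 <= y ->
  (x + y) `^ r <= 2 `^ r * (x `^ r + y `^ r).
Proof.
wlog xy : x y / x <= y => [wh|] r0 x0 y0.
  have [xy|/ltW yx] := leP x y; first exact: wh.
  by rewrite addrC [X in _ * X]addrC; exact: wh.
apply: (@le_trans _ _ ((2 * y) `^ r)).
  by apply: le_powR_l => //; lra.
by rewrite powRM // ler_wpM2l ?powR_ge0 // lerDr powR_ge0.
Qed.

Lemma powR_le_1D r s x : 0 <= r -> r <= s -> 0 <= x -> x `^ r <= 1 + x `^ s.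
Proof.
move=> r0 rs x0; have [x1|/ltW x1] := leP x 1.
  apply: (@le_trans _ _ 1); last by rewrite lerDl powR_ge0.
  by have := le_powR_l r x 1 r0 x0 x1; rewrite powR1.
apply: (@le_trans _ _ (x `^ s)); first by apply: ler_powR.
by rewrite lerDr.
Qed.

(** The sum is at most [n.+1] times its largest term, and the power of that term is one of the
    summands on the right. Convexity is avoided, so exponents below 1 are covered too. *)
Lemma powR_sum_le r (u : nat -> R) n : 0 <= r -> (forall i, 0 <= u i) ->
  (\sum_(i < n.+1) u i) `^ r <= n.+1%:R `^ r * \sum_(i < n.+1) u i `^ r.
Proof.
move=> r0 u0.
have [j _ jmax] : exists2 j : 'I_n.+1, true & forall i : 'I_n.+1, u i <= u j.
  exists [arg max_(i > (ord0 : 'I_n.+1)) u i]%O => //.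
  by case: arg_maxP => // j _ jm i; exact: jm.
apply: (@le_trans _ _ ((n.+1%:R * u j) `^ r)).
  apply: le_powR_l => //; first by rewrite sumr_ge0.
  by rewrite mulr_natl -[X in _ *+ X]card_ord -sumr_const ler_sum.
rewrite powRM // ler_wpM2l ?powR_ge0 // (bigD1 j) //= lerDl.
by rewrite sumr_ge0 // => i _; rewrite powR_ge0.
Qed.

End PowerInequalities.

(** * The Lyapunov function and its drift over one block *)

Definition decay_rate {R : realType} (beta : R) : R := 2^-1 `^ beta.

Lemma decay_rate_gt0 {R : realType} (beta : R) : 0 < decay_rate beta.
Proof. by rewrite powR_gt0. Qed.

Lemma decay_rate_lt1 {R : realType} (beta : R) :
  0 < beta -> decay_rate beta < 1.
Proof.
by move=> b0; rewrite -[ltRHS](one_powR beta) gt0_ltr_powR // ?nnegrE; lra.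
Qed.

Section Lyapunov.
Context {R : realType}.
Variables alpha beta A K : R.
Hypothesis bounds : [/\ 0 < beta, beta < alpha, 1 <= A & 1 <= K].

Local Notation q := (decay_rate beta).
(** Chosen so that [q * c = K ^ beta]: the price of enlarging the scale by [K] is already paid by
    the value of [lyap] during overflow. *)
Definition overflow_weight : R := K `^ beta / q.
Local Notation c := overflow_weight.

Hypothesis K_large : (2 * A) `^ alpha * K `^ (beta - alpha) <= q.

Definition lyap (x D : R) : R :=
  if `|x| <= D then D `^ beta else c * (`|x| `^ alpha * D `^ (beta - alpha)).

Lemma overflow_weight_ge1 : 1 <= c.
Proof.
have [b0 ba A1 K1] := bounds.
rewrite /c ler_pdivlMr ?decay_rate_gt0 // mul1r.
apply: (@le_trans _ _ 1); first exact/ltW/decay_rate_lt1.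
by rewrite -[leLHS](one_powR beta); apply: le_powR_l => //; lra.
Qed.

Let c_gt0 : 0 < c. Proof. exact: lt_le_trans ltr01 overflow_weight_ge1. Qed.

Lemma lyap_ge0 x D : 0 <= lyap x D.
Proof.
rewrite /lyap; case: ifP => _; first exact: powR_ge0.
by apply: mulr_ge0; [exact: ltW|rewrite mulr_ge0 ?powR_ge0].
Qed.

Let scale_pow_le1 D : 1 <= D -> D `^ (beta - alpha) <= 1.
Proof.
by have [_ ba _ _] := bounds => D1; rewrite -(powRr0 D) ler_powR //; lra.
Qed.

(** In overflow, split [|x| ^ beta] as [|x| ^ alpha * |x| ^ (beta - alpha)]; the second exponent is
    negative and [|x| > D], so replacing [|x|] by [D] there only increases it. *)
Lemma norm_powR_le_lyap x D : 1 <= D -> `|x| `^ beta <= lyap x D.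
Proof.
have [b0 ba A1 K1] := bounds.
move=> D1; rewrite /lyap; case: ifP => [xD|/negbT].
  by apply: le_powR_l => //; lra.
rewrite -ltNge => Dx.
apply: (@le_trans _ _ (`|x| `^ alpha * D `^ (beta - alpha))); last first.
  by rewrite ler_peMl ?mulr_ge0 ?powR_ge0 // overflow_weight_ge1.
have x0 : `|x| != 0 by apply: lt0r_neq0; lra.
have bE : beta = alpha + (beta - alpha) by ring.
rewrite {1}bE powRD ?x0 ?implybT //.
rewrite ler_wpM2l ?powR_ge0 // -opprB !powRN.
rewrite lef_pV2 ?posrE ?powR_gt0 //; try lra.
by apply: le_powR_l; lra.
Qed.

Lemma lyap_init x : lyap x 1 <= 1 + c * `|x| `^ alpha.
Proof.
rewrite /lyap !powR1 mulr1; case: ifP => _; last by rewrite lerDr.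
by rewrite lerDl; apply: mulr_ge0; [exact: ltW|exact: powR_ge0].
Qed.

Let lyap_noise (z x D : R) : 1 <= D -> ~~ (`|x| <= D) -> `|x| <= 2 * z ->
  lyap x D <= c * 2 `^ alpha * z `^ alpha.
Proof.
have [b0 ba A1 K1] := bounds.
move=> D1 xD xz; have z0 : 0 <= z by have := normr_ge0 x; lra.
rewrite /lyap (negbTE xD) -(mulrA c) ler_wpM2l ?(ltW c_gt0) // -powRM //.
apply: (@le_trans _ _ (`|x| `^ alpha)).
  by rewrite ler_piMr ?powR_ge0 // scale_pow_le1.
by apply: le_powR_l => //; lra.
Qed.

Let noise_coef_ge1 : 1 <= c * 2 `^ alpha.
Proof.
have [b0 ba A1 K1] := bounds.
have c1 := overflow_weight_ge1.
have : 1 <= 2 `^ alpha :> R by rewrite -[leLHS](powRr0 2) ler_powR //; lra.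
by nra.
Qed.

(** If the new state is in range, [D' ^ beta] is at most [q * D ^ beta + 1], the 1 coming from the
    floor of the scale. Otherwise [|x'| > D' >= D / 2], so [D / 4] is below [|x'| / 2] and
    [|x'| <= 2 * z]: the noise is to blame. *)
Lemma lyap_in_range (x D x' z : R) : 1 <= D -> `|x| <= D -> 0 <= z ->
  `|x'| <= D / 4 + z ->
  lyap x' (Num.max (D / 2) 1) <=
  q * lyap x D + c * 2 `^ alpha * (1 + z `^ alpha).
Proof.
have [b0 ba A1 K1] := bounds.
move=> D1 xD z0 x'D; set D' := Num.max _ _.
have D'1 : 1 <= D' by rewrite le_max lexx orbT.
have D'D : D / 2 <= D' by rewrite le_max lexx.
have cz := noise_coef_ge1.
have za := powR_ge0 z alpha.
have Db := powR_ge0 D beta.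
have q0 := decay_rate_gt0 beta.
have [x'D'|x'D'] := boolP (`|x'| <= D').
  rewrite /lyap x'D' xD.
  have : D' `^ beta <= q * D `^ beta + 1.
    rewrite /D' maxEle; case: ifP => _; first by rewrite powR1 lerDr; nra.
    by rewrite powRM; [rewrite /q mulrC; lra|lra|lra].
  by nra.
have : `|x'| <= 2 * z by move: x'D'; rewrite -ltNge; lra.
move=> /(lyap_noise _ _ _ D'1 x'D').
by have := mulr_ge0 (ltW q0) (lyap_ge0 x D); nra.
Qed.

(** Three cases: the enlarged scale catches the state, where the choice of [c] gives the
    contraction; the noise dominates [A * |x|], where [lyap_noise] applies; or
    [|x'| <= 2 * A * |x|], where [K_large] makes the factor [K ^ (beta - alpha)] beat the growth. *)
Lemma lyap_overflow (x D x' z : R) : 1 <= D -> ~~ (`|x| <= D) -> 0 <= z ->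
  `|x'| <= A * `|x| + z ->
  lyap x' (K * D) <=
  q * lyap x D + c * 2 `^ alpha * (1 + z `^ alpha).
Proof.
have [b0 ba A1 K1] := bounds.
move=> D1 xD z0 x'D; have D'1 : 1 <= K * D by nra.
have cz := noise_coef_ge1.
have za := powR_ge0 z alpha.
have q0 := decay_rate_gt0 beta.
have W0 := lyap_ge0 x D.
have cz0 : 0 <= c * 2 `^ alpha * (1 + z `^ alpha) by nra.
have [x'D'|x'D'] := boolP (`|x'| <= K * D).
  suff : lyap x' (K * D) <= q * lyap x D by lra.
  rewrite /lyap x'D' (negbTE xD) /c powRM; [|lra|lra].
  rewrite mulrA [q * _]mulrC divfK ?gt_eqF // ler_wpM2l ?powR_ge0 //.
  have bE : beta = alpha + (beta - alpha) by ring.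
  rewrite {1}bE powRD; last by apply/implyP => _; apply: lt0r_neq0; lra.
  rewrite ler_wpM2r ?powR_ge0 //; move: xD; rewrite -ltNge => xD.
  by apply: le_powR_l; lra.
have [zx|xz] := leP z (A * `|x|); last first.
  have /(lyap_noise _ _ _ D'1 x'D') : `|x'| <= 2 * z by lra.
  by have := mulr_ge0 (ltW q0) W0; nra.
suff : lyap x' (K * D) <= q * lyap x D by lra.
rewrite /lyap (negbTE x'D') (negbTE xD) [leRHS]mulrCA ler_wpM2l ?(ltW c_gt0) //.
have x0 := normr_ge0 x.
apply: (@le_trans _ _ ((2 * A * `|x|) `^ alpha * (K * D) `^ (beta - alpha))).
  rewrite ler_wpM2r ?powR_ge0 //; apply: le_powR_l => //; lra.
rewrite [(2 * A * _) `^ _]powRM; [|lra|by []].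
rewrite [(K * D) `^ _]powRM; [|lra|lra].
by rewrite mulrACA ler_wpM2r // mulr_ge0 ?powR_ge0.
Qed.

End Lyapunov.

Lemma zoom_factor_exists {R : realType} (alpha beta A : R) :
  0 < beta -> beta < alpha -> 1 <= A ->
  exists2 K : R, 1 <= K &
    (2 * A) `^ alpha * K `^ (beta - alpha) <= decay_rate beta.
Proof.
move=> b0 ba A1; have q0 := decay_rate_gt0 beta.
have q1 := decay_rate_lt1 beta b0.
set L := (2 * A) `^ alpha / decay_rate beta.
have L1 : 1 <= L.
  rewrite ler_pdivlMr // mul1r (le_trans (ltW q1)) //.
  by rewrite -[leLHS](one_powR alpha); apply: le_powR_l; lra.
(* This [K] solves the required inequality with equality, and [L >= 1] gives [K >= 1]. *)
exists (L `^ (alpha - beta)^-1).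
  by rewrite -[leLHS](powRr0 L) ler_powR // invr_ge0; lra.
rewrite -powRrM.
have -> : (alpha - beta)^-1 * (beta - alpha) = -1 by field; apply/eqP; lra.
rewrite powR_inv1; last by lra.
by rewrite /L invf_div mulrCA mulfV ?mulr1 // gt_eqF // powR_gt0; lra.
Qed.

(** * Positional digits of a symbol *)

Definition digit (B r s : nat) : nat := (s %/ B ^ r) %% B.

(** Applied below with [s < B ^ m], where the right-hand side is [s] itself and the receiver
    recovers the symbol exactly. *)
Lemma sum_digit (B m s : nat) : (0 < B)%N ->
  (\sum_(r < m) digit B r s * B ^ r = s %% B ^ m)%N.
Proof.
move=> B0; elim: m => [|m IH]; first by rewrite big_ord0 modn1.
rewrite big_ord_recr /= IH /digit.
have lt1 : (s %/ B ^ m %% B < B)%N by rewrite ltn_mod.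
have lt2 : (s %% B ^ m < B ^ m)%N by rewrite ltn_mod expn_gt0 B0.
have lt3 : ((s %/ B ^ m) %% B * B ^ m + s %% B ^ m < B ^ m.+1)%N.
  by rewrite expnS -ltn_divLR ?divnMDl ?expn_gt0 ?B0 // (divn_small lt2) addn0.
rewrite [in RHS](divn_eq s (B ^ m)) [in RHS](divn_eq (s %/ B ^ m) B).
by rewrite mulnDl -mulnA -expnS -addnA modnMDl (modn_small lt3) addnC.
Qed.

(** * The block coding scheme and the agreement of its two ends *)

Section Codec.
Context {R : realType}.
Variables (M p N : nat) (a K : R).
Hypothesis symbols : (M.+1 ^ p.+1 = N.+2)%N.
Hypothesis a_ge1 : 1 <= a.
Hypothesis K_ge1 : 1 <= K.
Hypothesis N_large : 8 * a ^+ p.+1 <= N%:R.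

(** Rounding down on a grid of spacing [2 * D / N]; the endpoint [x = D] gets symbol [N], which
    leaves [N.+1] free for overflow. *)
Definition quantize (D x : R) : nat :=
  if `|x| <= D then Num.truncn ((x / D + 1) * (N%:R / 2)) else N.+1.

Definition grid_point (s : nat) : R := 2 * s%:R / N%:R - 1.

Fixpoint scale (y : nat -> R) (b : nat) : R :=
  if b is b'.+1 then
    if `|y b'| <= scale y b' then Num.max (scale y b' / 2) 1
    else K * scale y b'
  else 1.

Fixpoint decoded_scale (s : nat -> nat) (b : nat) : R :=
  if b is b'.+1 then
    if s b' == N.+1 then K * decoded_scale s b'
    else Num.max (decoded_scale s b' / 2) 1
  else 1.

(* During block b (times b * p.+1, ..., b * p.+1 + p) the encoder sends, digit
   by digit, the symbol of the state at the start of the block. *)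
Definition encoder (k : nat) (x : 'I_k.+1 -> R) : 'I_M.+1 :=
  let y b := x (inord (b * p.+1)) in
  inord (digit M.+1 (k %% p.+1)%N
           (quantize (scale y (k %/ p.+1)%N) (y (k %/ p.+1)%N))).

(** For a block not yet fully sent, [inord] falls back to index 0 and the value is meaningless;
    [controller] reads it only at the last step of a block. *)
Definition received (k : nat) (c : 'I_k.+1 -> 'I_M.+1) (b : nat) : nat :=
  \sum_(r < p.+1) c (inord (b * p.+1 + r)) * M.+1 ^ r.

(** The last step of a block cancels the image, under [p.+1] steps of noiseless open-loop motion, of
    the decoded state at the block start. *)
Definition controller (k : nat) (c : 'I_k.+1 -> 'I_M.+1) : R :=
  let s := received k c in
  let b := (k %/ p.+1)%N in
  if (k %% p.+1)%N == p then
    if s b == N.+1 then 0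
    else a ^+ p.+1 * (decoded_scale s b * grid_point (s b))
  else 0.

Let bounds : [/\ 1 <= a, 1 <= K & 0 < N%:R :> R].
Proof.
split=> //; apply: lt_le_trans N_large.
by rewrite mulr_gt0 // exprn_gt0 // (lt_le_trans ltr01).
Qed.

Lemma scale_ge1 y b : 1 <= scale y b.
Proof.
have K1 := K_ge1; elim: b => //= b IH; case: ifP => _; last by nra.
by rewrite le_max lexx orbT.
Qed.

Lemma quantize_in_range (D x : R) : 1 <= D -> `|x| <= D ->
  (quantize D x <= N)%N /\ `|x - D * grid_point (quantize D x)| <= 2 * D / N%:R.
Proof.
move=> D1 xD; have [_ _ N0] := bounds; rewrite /quantize xD.
set t := (X in Num.truncn X).
have xD1 : -1 <= x / D <= 1.
  by move: xD; rewrite ler_norml ler_pdivlMr ?ler_pdivrMr; lra.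
have t0 : 0 <= t by rewrite /t mulr_ge0; lra.
have tN : t <= N%:R by rewrite /t; nra.
have /andP[t1 t2] := truncn_itv t0.
split; first by rewrite -(ler_nat R); exact: le_trans t1 tN.
(* The error is the grid spacing times the fractional part of [t]. *)
have -> : x - D * grid_point (Num.truncn t) =
    2 * D / N%:R * (t - (Num.truncn t)%:R).
  rewrite /grid_point /t; field; apply/andP; split; apply: lt0r_neq0; lra.
rewrite normrM ger0_norm; last by rewrite !mulr_ge0 ?invr_ge0; lra.
rewrite ler_piMr //; first by rewrite !mulr_ge0 ?invr_ge0; lra.
by move: t2; rewrite -natr1 ger0_norm; lra.
Qed.

Lemma quantize_overflowE (D x : R) : 1 <= D ->
  (quantize D x == N.+1) = ~~ (`|x| <= D).
Proof.
move=> D1; have [xD|xD] := boolP (`|x| <= D).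
  by have [sN _] := quantize_in_range D x D1 xD; rewrite ltn_eqF.
by rewrite /quantize (negbTE xD) eqxx.
Qed.

Lemma quantize_lt (D x : R) : 1 <= D -> (quantize D x < M.+1 ^ p.+1)%N.
Proof.
move=> D1; rewrite symbols; have [xD|xD] := boolP (`|x| <= D).
  by have [sN _] := quantize_in_range D x D1 xD; rewrite ltnS leqW.
by rewrite /quantize (negbTE xD).
Qed.

Lemma eq_scale (y y' : nat -> R) b :
  (forall j, (j < b)%N -> y j = y' j) -> scale y b = scale y' b.
Proof.
elim: b => //= b IH yy'; rewrite IH ?yy' // => j jb.
by apply: yy'; exact: ltnW.
Qed.

(** The symbol alone reveals whether overflow occurred, so both recursions always take the same
    branch. *)
Lemma decoded_scaleE (y : nat -> R) (s : nat -> nat) b :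
  (forall j, (j < b)%N -> s j = quantize (scale y j) (y j)) ->
  decoded_scale s b = scale y b.
Proof.
elim: b => //= b IH sE; rewrite sE // quantize_overflowE ?scale_ge1 //.
rewrite IH; last by move=> j jb; apply: sE; exact: ltnW.
by rewrite if_neg.
Qed.

(** * The closed loop along a single sample path *)

Section Path.
Variables (x0 : R) (z : nat -> R).

Local Notation path := (traj encoder controller a x0 z).
Definition path_state (n : nat) : R := nth 0 (path n) n.
Local Notation x := path_state.
Local Notation y := (fun b => x (b * p.+1)).

Lemma size_traj n : size (path n) = n.+1.
Proof. by elim: n => //= n IH; rewrite size_rcons IH. Qed.

Lemma nth_traj n i : (i <= n)%N -> nth 0 (path n) i = x i.
Proof.
elim: n => [|n IH]; first by case: i.
rewrite leq_eqVlt => /predU1P[->//|i_n] /=.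
by rewrite nth_rcons size_traj i_n IH.
Qed.

Lemma qcodes_traj n (j : 'I_n.+1) :
  @qcodes R M.+1 encoder n (path n) j = digit M.+1 (j %% p.+1)%N
    (quantize (scale y (j %/ p.+1)%N) (y (j %/ p.+1)%N)) :> nat.
Proof.
rewrite /qcodes /encoder inordK ?ltn_mod //.
(* Causality: the block starts consulted at time [j] are not later than [j], so [inord] returns the
   intended index. *)
have yE b : (b <= j %/ p.+1)%N ->
    nth 0 (path n) (inord (b * p.+1) : 'I_j.+1) = x (b * p.+1).
  move=> bj; have bj' : (b * p.+1 <= j)%N.
    by rewrite (leq_trans _ (leq_trunc_div j p.+1)) // leq_mul2r bj orbT.
  rewrite inordK ?ltnS // nth_traj //.
  by rewrite (leq_trans bj') // -ltnS.
rewrite yE // (@eq_scale _ y) // => b bj; exact/yE/ltnW.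
Qed.

Lemma control_traj n : control encoder controller n (path n) =
  if ((n %% p.+1)%N == p) && (`|y (n %/ p.+1)%N| <= scale y (n %/ p.+1)%N) then
    a ^+ p.+1 * (scale y (n %/ p.+1)%N *
      grid_point (quantize (scale y (n %/ p.+1)%N) (y (n %/ p.+1)%N)))
  else 0.
Proof.
rewrite /control /controller; case: ifP => //= /eqP np.
set s := received n _.
have sE b : (b <= n %/ p.+1)%N -> s b = quantize (scale y b) (y b).
  (* The symbol fits in [p.+1] digits, so reducing it modulo [M.+1 ^ p.+1] changes nothing and
     exposes the digit sum. *)
  move=> bn; rewrite -[RHS](@modn_small _ (M.+1 ^ p.+1)); last first.
    by rewrite quantize_lt // scale_ge1.
  rewrite -sum_digit // /s /received; apply: eq_bigr => r _; congr (_ * _)%N.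
  (* As [n] is the last step of its block, every digit of this block and of the earlier ones has
     been sent. *)
  have bn' : (b * p.+1 + r < n.+1)%N.
    have := divn_eq n p.+1; rewrite np => {1}->; rewrite ltnS leq_add //.
      by rewrite leq_mul2r bn orbT.
    by rewrite -ltnS.
  rewrite qcodes_traj inordK // modnMDl modn_small // divnMDl //.
  by rewrite divn_small // addn0.
rewrite sE // quantize_overflowE ?scale_ge1 //.
rewrite (@decoded_scaleE y); last by move=> j jn; apply: sE; exact: ltnW.
by rewrite if_neg.
Qed.

Lemma path_stateS n :
  x n.+1 = a * x n + z n - control encoder controller n (path n).
Proof. by rewrite /path_state /= nth_rcons size_traj ltnn eqxx. Qed.

Definition block_noise (b : nat) : R := \sum_(i < p.+1) `|z (b * p.+1 + i)|.

Lemma block_noise_ge0 b : 0 <= block_noise b.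
Proof. exact: sumr_ge0. Qed.

(** For [r <= p] no control has acted yet in the block; since [a >= 1], each noise term is amplified
    by at most [a ^+ r]. *)
Let free_evolution b r : (r <= p)%N ->
  `|x (b * p.+1 + r) - a ^+ r * y b| <=
  a ^+ r * \sum_(i < r) `|z (b * p.+1 + i)|.
Proof.
have [a1 _ _] := bounds.
elim: r => [|r IH] rp.
  by rewrite addn0 expr0 mul1r subrr normr0 big_ord0 mulr0.
rewrite addnS path_stateS control_traj.
rewrite modnMDl modn_small ?(ltn_eqF rp) /=; last by rewrite ltnW.
rewrite subr0 big_ord_recr /= exprS.
set u := x _; set v := z _; set S := \sum_(i < r) _; set e := a ^+ r * y b.
have ar1 : 1 <= a ^+ r by rewrite exprn_ege1.
have -> : a * u + v - a * a ^+ r * y b = a * (u - e) + v.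
  by rewrite /e; ring.
rewrite (le_trans (ler_normD _ _)) // normrM ger0_norm; last by lra.
rewrite mulrDr lerD // -?mulrA.
  by rewrite ler_wpM2l //; [lra|exact/IH/ltnW].
by have v0 := normr_ge0 v; rewrite mulrA ler_peMl //; nra.
Qed.

(** Carries bounds at block starts over to the times inside a block. *)
Lemma norm_path_le b r : (r <= p)%N ->
  `|x (b * p.+1 + r)| <= a ^+ p.+1 * (`|y b| + block_noise b).
Proof.
move=> rp; have [a1 _ _] := bounds.
have ar : a ^+ r <= a ^+ p.+1 by rewrite ler_weXn2l // ltnW.
have ar0 : 0 <= a ^+ r by rewrite exprn_ge0 //; lra.
have h := free_evolution b r rp.
set S := \sum_(i < r) _ in h.
have S0 : 0 <= S by exact: sumr_ge0.
have SB : S <= block_noise b.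
  rewrite /S /block_noise.
  rewrite (big_ord_widen p.+1 (fun i => `|z (b * p.+1 + i)|)) 1?ltnW //.
  by rewrite [leRHS](bigID (fun i : 'I_p.+1 => (i < r)%N)) /= lerDl sumr_ge0.
have -> : x (b * p.+1 + r) =
  (x (b * p.+1 + r) - a ^+ r * y b) + a ^+ r * y b by ring.
rewrite (le_trans (ler_normD _ _)) // normrM (ger0_norm ar0).
apply: (@le_trans _ _ (a ^+ r * (`|y b| + S))); first by lra.
by apply: ler_pM => //; [rewrite addr_ge0|rewrite lerD2l].
Qed.

(** [p] steps of free evolution followed by the single controlled step. *)
Lemma block_evolution b :
  exists2 e : R, `|e| <= a ^+ p.+1 * block_noise b &
  y b.+1 = a ^+ p.+1 * y b + e - (if `|y b| <= scale y b then
     a ^+ p.+1 * (scale y b * grid_point (quantize (scale y b) (y b))) else 0).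
Proof.
have [a1 _ _] := bounds.
have h := free_evolution b p (leqnn p).
exists (a * (x (b * p.+1 + p) - a ^+ p * y b) + z (b * p.+1 + p)); last first.
  have -> : (b.+1 * p.+1 = (b * p.+1 + p).+1)%N by lia.
  rewrite path_stateS control_traj modnMDl modn_small // eqxx /=.
  rewrite divnMDl // divn_small // addn0; congr (_ - _).
  by rewrite exprS; ring.
rewrite (le_trans (ler_normD _ _)) // normrM (ger0_norm (_ : 0 <= a)); last lra.
rewrite /block_noise big_ord_recr /= mulrDr lerD //.
  by rewrite exprS -mulrA ler_wpM2l //; lra.
by rewrite ler_peMl // exprn_ege1.
Qed.

Lemma lyap_path (alpha beta : R) (A := a ^+ p.+1) b :
  0 < beta -> beta < alpha ->
  (2 * A) `^ alpha * K `^ (beta - alpha) <= decay_rate beta ->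
  lyap alpha beta K (y b.+1) (scale y b.+1) <=
  decay_rate beta * lyap alpha beta K (y b) (scale y b) +
  overflow_weight beta K * 2 `^ alpha * (1 + (A * block_noise b) `^ alpha).
Proof.
move=> b0 ba KA; have [a1 K1 N0] := bounds.
have A1 : 1 <= A by exact: exprn_ege1.
have D1 := scale_ge1 y b.
have z0 : 0 <= A * block_noise b.
  by rewrite mulr_ge0 ?block_noise_ge0 //; lra.
have [e eB yE] := block_evolution b.
rewrite [scale y b.+1]/=; case: ifPn yE => yD yE.
  apply: (lyap_in_range alpha beta A K) => //.
  have [_ err] := quantize_in_range _ _ D1 yD.
  set w := scale y b * _ in yE err.
  have -> : y b.+1 = A * (y b - w) + e by rewrite yE /A; ring.
  rewrite (le_trans (ler_normD _ _)) // lerD // normrM ger0_norm; last lra.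
  apply: (@le_trans _ _ (A * (2 * scale y b / N%:R))).
    by rewrite ler_wpM2l //; lra.
  (* Here the 8 in [N_large] is used: the amplified quantization error [A * (2 * D / N)] is at most
     [D / 4], as [lyap_in_range] asks. *)
  rewrite !mulrA ler_pdivrMr //; have := N_large; rewrite -/A => AN.
  by nra.
apply: (lyap_overflow alpha beta A K) => //.
rewrite yE subr0 (le_trans (ler_normD _ _)) // lerD // normrM ger0_norm //.
by rewrite -/A; lra.
Qed.

End Path.
End Codec.

(** * Measurability of the encoder *)

Section Measurability.
Import numFieldNormedType.Exports.
Context {R : realType}.

(** A generating box bounds all coordinates, so the open half-space [x i < c] is written as a
    countable union of boxes: [j] approaches [c] from below in coordinate [i], and [k] exhausts the
    other coordinates. *)
Lemma measurable_coordinate n (i : 'I_n) :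
  measurable_fun setT (fun x : g_sigma_algebraType (@Rn_boxes R n) => x i).
Proof.
apply: (measurability _ (RGenInftyO.measurableE R)) => //.
move=> _ [_ [c ->] <-]; rewrite setTI.
pose box (j k : nat) : set (g_sigma_algebraType (@Rn_boxes R n)) :=
  [set x | forall l, x l <= if l == i then c - j.+1%:R^-1 else k%:R].
rewrite [X in measurable X](_ : _ = \bigcup_j \bigcup_k box j k).
  apply: bigcupT_measurable => j; apply: bigcupT_measurable => k.
  apply: sub_sigma_algebra.
  by exists (fun l => if l == i then c - j.+1%:R^-1 else k%:R).
apply/seteqP; split => [x|x [j _ [k _ /(_ i)]]] /=; rewrite in_itv /=.
  move=> xc; have [j jP] : exists j : nat, j.+1%:R^-1 < c - x i.
    exists (Num.truncn (c - x i)^-1).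
    rewrite invf_plt ?posrE ?subr_gt0 ?ltr0Sn //.
    exact: truncnS_gt.
  exists j => //.
  exists (\max_(l < n) (Num.truncn (x l)).+1)%N => // l.
  case: eqP => [->|_]; first by rewrite lerBrDl -lerBrDr ltW.
  apply: (le_trans (ltW (truncnS_gt _))); rewrite ler_nat.
  exact: (leq_bigmax l).
rewrite eqxx => xi; apply: (le_lt_trans xi).
by rewrite ltrBlDr ltrDl invr_gt0.
Qed.

Lemma measurable_nat_fun {d : measure_display} {T : measurableType d}
    (h : T -> nat) :
  (forall k, measurable (h @^-1` [set k])) -> measurable_fun setT h.
Proof.
move=> mh _ Y _; rewrite setTI.
rewrite (_ : h @^-1` Y = \bigcup_(k in Y) h @^-1` [set k]).
  by apply: bigcup_measurable => k _; exact: mh.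
apply/seteqP; split => [t Yt|t [k Yk /= hk]]; first by exists (h t).
by rewrite /= hk.
Qed.

Lemma measurable_truncn {d : measure_display} {T : measurableType d}
    (h : T -> R) :
  measurable_fun setT h -> measurable_fun setT (fun t => Num.truncn (h t)).
Proof.
move=> mh; apply: measurable_nat_fun => k.
have mc (c : R) : measurable_fun setT (fun _ : T => c) by exact: measurable_cst.
have mkS : measurable_fun setT (fun t : T => h t < k.+1%:R).
  exact: measurable_fun_ltr.
(* Negative reals truncate to 0, so the fibre over [k = 0] has no lower bound. *)
have mk : measurable_fun setT (fun t : T => (k == 0%N) || (k%:R <= h t)).
  by apply: measurable_or => //; exact: measurable_fun_ler.
have := measurable_and mk mkS.
move=> /(_ measurableT [set true] I); rewrite setTI.
congr (measurable _); apply/seteqP; split => t /=.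
  move=> /andP[k0 hk]; have [h0|h0] := leP 0 (h t).
    apply: truncn_def; rewrite hk andbT; by case/orP: k0 => // /eqP ->.
  have k00 : k = 0%N.
    case/orP: k0 => [/eqP //|kh]; have := le_lt_trans kh h0.
    by rewrite ltrn0.
  by rewrite k00 truncn_floor leNgt h0.
move=> <-; rewrite truncnS_gt andbT.
case: eqP => //= /eqP; rewrite -lt0n => t0.
have h0 : 0 <= h t.
  by rewrite leNgt; apply/negP => h0; move: t0; rewrite truncn_floor leNgt h0.
by have /andP[] := truncn_itv h0.
Qed.

Lemma measurable_inv_ge0 {d : measure_display} {T : measurableType d}
    (h : T -> R) :
  measurable_fun setT h -> (forall t, 0 <= h t) ->
  measurable_fun setT (fun t => (h t)^-1).
Proof.
move=> mh h0; rewrite (_ : (fun t => _) = (fun t => h t `^ (-1))).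
  apply: (measurableT_comp (f := fun x => x `^ (-1))) mh.
  exact: measurable_powR.
by apply/funext => t; rewrite powR_inv1.
Qed.

Lemma encoder_measurable (M p N : nat) (K : R) (k : nat) :
  1 <= K -> Rn_measurable_quant (encoder M p N K k).
Proof.
move=> K1 c; pose E := g_sigma_algebraType (@Rn_boxes R k.+1).
pose y (x : E) b := x (inord (b * p.+1)) : R.
have my b : measurable_fun setT (fun x : E => y x b).
  exact: measurable_coordinate.
have mD b : measurable_fun setT (fun x : E => scale K (y x) b).
  elim: b => [|b IH] /=; first exact: measurable_cst.
  apply: measurable_fun_ifT.
  - by apply: measurable_fun_ler => //; exact: measurableT_comp.
  - apply: measurable_maxr; last exact: measurable_cst.
    by apply: measurable_funM => //; exact: measurable_cst.
  - by apply: measurable_funM => //; exact: measurable_cst.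
have mS b :
    measurable_fun setT (fun x : E => quantize N (scale K (y x) b) (y x b)).
  apply: measurable_fun_ifT.
  - by apply: measurable_fun_ler => //; exact: measurableT_comp.
  - apply: measurable_truncn; apply: measurable_funM; last exact: measurable_cst.
    apply: measurable_funD; last exact: measurable_cst.
    apply: measurable_funM => //.
    by apply: measurable_inv_ge0 => // x; rewrite (le_trans ler01) ?scale_ge1.
  - exact: measurable_cst.
(* Every subset of [nat] is measurable, so composing the measurable symbol with any map out of
   [nat], here the digit to be sent, is harmless. *)
pose dec s : 'I_M.+1 := inord (digit M.+1 (k %% p.+1) s).
have := mS (k %/ p.+1)%N measurableT (dec @^-1` [set c]) I.
by rewrite setTI.
Qed.

End Measurability.

(** * Integral estimates *)

Section Integration.
Context {R : realType} {d : measure_display} {T : measurableType d}.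
Variable P : probability T R.

(** The integral of a nonnegative function is a supremum over the simple functions below it, which
    is monotone for arbitrary functions. *)
Lemma ge0_le_integral_nonmeasurable (f g : T -> \bar R) :
  (forall t, 0 <= f t)%E -> (forall t, f t <= g t)%E ->
  (\int[P]_t f t <= \int[P]_t g t)%E.
Proof.
move=> f0 fg; have g0 t : (0 <= g t)%E by exact: le_trans (fg t).
rewrite !ge0_integralTE //; apply: ereal_sup_le => _ [h hf <-].
by exists h => // t; exact: le_trans (fg t).
Qed.

(** One shape serves the start of the majorant, its recursion and the final bound on the state. *)
Lemma integral_lin_le (u v : T -> R) (Bu Bv a b c : R) :
  measurable_fun setT u -> measurable_fun setT v ->
  (forall t, 0 <= u t) -> (forall t, 0 <= v t) ->
  0 <= a -> 0 <= b -> 0 <= c ->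
  (\int[P]_t (u t)%:E <= Bu%:E)%E -> (\int[P]_t (v t)%:E <= Bv%:E)%E ->
  (\int[P]_t (a * u t + b * v t + c)%:E <= (a * Bu + b * Bv + c)%:E)%E.
Proof.
move=> mu mv u0 v0 a0 b0 c0 uB vB.
under eq_integral do rewrite !EFinD !EFinM.
have mEu : measurable_fun setT (fun t => (u t)%:E) by exact/measurable_EFinP.
have mEv : measurable_fun setT (fun t => (v t)%:E) by exact/measurable_EFinP.
have mau : measurable_fun setT (fun t => a%:E * (u t)%:E)%E.
  exact: measurable_funeM.
have mbv : measurable_fun setT (fun t => b%:E * (v t)%:E)%E.
  exact: measurable_funeM.
rewrite ge0_integralD //; first last.
- exact: emeasurable_funD.
- by move=> t _; rewrite -!EFinM -EFinD lee_fin addr_ge0 ?mulr_ge0.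
rewrite ge0_integralD //; first last.
- by move=> t _; rewrite -EFinM lee_fin mulr_ge0.
- by move=> t _; rewrite -EFinM lee_fin mulr_ge0.
rewrite !ge0_integralZl_EFin //; first last.
- by move=> t _; rewrite lee_fin.
- by move=> t _; rewrite lee_fin.
have -> : (\int[P]_t c%:E = c%:E)%E.
  by rewrite (integral_cst P measurableT c%:E) /= probability_setT mule1.
by rewrite !EFinD !EFinM; apply: leeD => //; apply: leeD; apply: lee_wpmul2l.
Qed.

Lemma integral_sum_le (v : nat -> T -> R) (B : R) (n : nat) :
  (forall i, measurable_fun setT (v i)) -> (forall i t, 0 <= v i t) ->
  (forall i, \int[P]_t (v i t)%:E <= B%:E)%E ->
  (\int[P]_t (\sum_(i < n) v i t)%:E <= (n%:R * B)%:E)%E.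
Proof.
move=> mv v0 vB; elim: n => [|n IH].
  under eq_integral do rewrite big_ord0.
  by rewrite integral0 mul0r.
have ms : measurable_fun setT (fun t => \sum_(i < n) v i t).
  by apply: measurable_sum => i; exact: mv.
have s0 t : 0 <= \sum_(i < n) v i t by exact: sumr_ge0.
have := integral_lin_le _ _ _ _ 1 1 0 ms (mv n) s0 (v0 n) ler01 ler01 (lexx 0)
  IH (vB n).
under eq_integral do rewrite !mul1r addr0.
under [in X in _ -> X]eq_integral do rewrite big_ord_recr /=.
by rewrite !mul1r addr0 -natr1 mulrDl mul1r.
Qed.

Lemma limn_esup_lty (u : nat -> \bar R) (B : R) :
  (forall n, u n <= B%:E)%E -> (limn_esup u < +oo)%E.
Proof.
move=> uB; rewrite limn_esup_lim; apply: le_lt_trans (ltry B).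
apply: lime_le; first exact: is_cvg_esups.
by apply: nearW => n; apply: ge_ereal_sup => _ [k _ <-]; exact: uB.
Qed.

End Integration.

(** * Choice of the block length *)

Lemma block_length_exists {R : realType} (a : R) (M : nat) :
  1 <= a -> a < M.+1%:R ->
  exists p N : nat, (M.+1 ^ p.+1 = N.+2)%N /\ 8 * a ^+ p.+1 <= N%:R.
Proof.
move=> a1 aM; have M0 : 0 < M.+1%:R :> R by [].
have r1 : `|a / M.+1%:R| < 1.
  by rewrite ger0_norm ?divr_ge0 ?ltr_pdivrMr ?mul1r //; lra.
(* The ratio [1 / 10] gives [10 * a ^+ n <= M.+1 ^ n]; as [a ^+ n >= 1], subtracting the 2 from
   [N.+2] still leaves [8 * a ^+ n]. *)
have /cvgrPdist_lt /(_ 10^-1) := cvg_expr r1.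
case; first by lra.
move=> n _ /(_ n (leqnn n)); rewrite sub0r normrN.
rewrite ger0_norm ?exprn_ge0 ?divr_ge0 //; last by lra.
rewrite expr_div_n ltr_pdivrMr ?exprn_gt0 // => an.
have an1 : 1 <= a ^+ n by exact: exprn_ege1.
have Mn : 10 * a ^+ n <= (M.+1 ^ n)%:R by rewrite natrX; lra.
have [N NE] : exists N, (M.+1 ^ n = N.+2)%N.
  exists (M.+1 ^ n - 2)%N; suff : (2 <= M.+1 ^ n)%N by lia.
  by rewrite -(ler_nat R); lra.
case: n NE an1 Mn {an} => [//|p] NE an1 Mn.
exists p, N; split => //.
by move: Mn; rewrite NE -natr1 -natr1; lra.
Qed.

(** * Uniform moment bound for the closed loop *)

Section MomentBound.
Context {R : realType} {d : measure_display} {T : measurableType d}.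
Variables (P : probability T R) (M p N : nat) (a K alpha beta : R).
Variables (X0 : T -> R) (Z : nat -> T -> R) (B0 C : R).
Hypothesis symbols : (M.+1 ^ p.+1 = N.+2)%N.
Hypothesis a_ge1 : 1 <= a.
Hypothesis K_ge1 : 1 <= K.
Hypothesis N_large : 8 * a ^+ p.+1 <= N%:R.
Hypothesis beta_gt0 : 0 < beta.
Hypothesis beta_alpha : beta < alpha.
Hypothesis K_large :
  (2 * a ^+ p.+1) `^ alpha * K `^ (beta - alpha) <= decay_rate beta.
Hypothesis X0_measurable : measurable_fun setT X0.
Hypothesis Z_measurable : forall n, measurable_fun setT (Z n).
Hypothesis X0_moment : (\int[P]_w (`|X0 w| `^ alpha)%:E <= B0%:E)%E.
Hypothesis Z_moment : forall n, (\int[P]_w (`|Z n w| `^ alpha)%:E <= C%:E)%E.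

Local Notation A := (a ^+ p.+1).
Local Notation m := p.+1.
Local Notation q := (decay_rate beta).
Local Notation c := (overflow_weight beta K).

(** A sum of powers instead of a power of the sum, so that the moment hypothesis applies term by
    term; [powR_sum_le] supplies the comparison. *)
Let noise_pow (b : nat) (w : T) : R :=
  \sum_(i < m) `|Z (b * m + i) w| `^ alpha.

(* Integrating a measurable pathwise majorant of the Lyapunov function avoids
   proving that the closed-loop states are measurable. The null term of the
   base case puts it in the shape of integral_lin_le. *)
Fixpoint majorant (b : nat) (w : T) : R :=
  if b is b'.+1 then
    q * majorant b' w
    + c * 2 `^ alpha * (A `^ alpha * m%:R `^ alpha) * noise_pow b' w
    + c * 2 `^ alpha
  else c * `|X0 w| `^ alpha + 0 * `|X0 w| `^ alpha + 1.

Let A_ge1 : 1 <= A. Proof. exact: exprn_ege1. Qed.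
Let A_ge0 : 0 <= A. Proof. exact: le_trans ler01 A_ge1. Qed.
Let alpha_ge0 : 0 <= alpha. Proof. exact/ltW/(lt_trans beta_gt0). Qed.
Let c_ge0 : 0 <= c.
Proof.
apply: le_trans ler01 _; apply: (overflow_weight_ge1 alpha beta A K).
by split.
Qed.
Let q_ge0 : 0 <= q. Proof. exact/ltW/decay_rate_gt0. Qed.

Let coef_ge0 : 0 <= c * 2 `^ alpha.
Proof. by rewrite mulr_ge0 ?powR_ge0. Qed.

Let noise_coef_ge0 : 0 <= c * 2 `^ alpha * (A `^ alpha * m%:R `^ alpha).
Proof. by rewrite mulr_ge0 // mulr_ge0 ?powR_ge0. Qed.

Let measurable_abs_powR (h : T -> R) :
  measurable_fun setT h -> measurable_fun setT (fun w => `|h w| `^ alpha).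
Proof.
move=> mh; apply: (measurableT_comp (f := fun x => x `^ alpha)).
  exact: measurable_powR.
exact: measurableT_comp.
Qed.

Let noise_pow_ge0 b w : 0 <= noise_pow b w.
Proof. by apply: sumr_ge0 => i _; exact: powR_ge0. Qed.

Let measurable_noise_pow b : measurable_fun setT (noise_pow b).
Proof. by apply: measurable_sum => i; exact: measurable_abs_powR. Qed.

Let noise_pow_moment b : (\int[P]_w (noise_pow b w)%:E <= (m%:R * C)%:E)%E.
Proof.
apply: (integral_sum_le P (fun i w => `|Z (b * m + i) w| `^ alpha)) => //.
by move=> i; exact: measurable_abs_powR.
Qed.

Let majorant_ge0 b w : 0 <= majorant b w.
Proof.
by elim: b => [|b IH] /=; apply: addr_ge0 => //; apply: addr_ge0;
  apply: mulr_ge0 => //; exact: powR_ge0.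
Qed.

Let measurable_majorant b : measurable_fun setT (majorant b).
Proof.
by elim: b => [|b IH] /=; do 2 ?[apply: measurable_funD];
  try apply: measurable_funM; do ?[exact: measurable_cst] => //;
  exact: measurable_abs_powR.
Qed.

Let C_ge0 : 0 <= C.
Proof.
rewrite -lee_fin; apply: le_trans (Z_moment 0).
by apply: integral_ge0 => w _; rewrite lee_fin powR_ge0.
Qed.

Let B0_ge0 : 0 <= B0.
Proof.
rewrite -lee_fin; apply: le_trans X0_moment.
by apply: integral_ge0 => w _; rewrite lee_fin powR_ge0.
Qed.

Lemma majorant_moment :
  exists B : R, forall b, (\int[P]_w (majorant b w)%:E <= B%:E)%E.
Proof.
set e := c * 2 `^ alpha * (A `^ alpha * m%:R `^ alpha) * (m%:R * C)
         + c * 2 `^ alpha.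
have q1 : q < 1 by exact: decay_rate_lt1.
have e0 : 0 <= e.
  by apply: addr_ge0 => //; apply: mulr_ge0 => //; exact: mulr_ge0.
have cB0 : 0 <= c * B0 by exact: mulr_ge0.
(* [e / (1 - q)] is the fixed point of [u -> q * u + e]. Adding the initial bound keeps
   [q * B + e <= B] because [q < 1]. *)
pose B := c * B0 + 1 + e / (1 - q).
have eB : e = (1 - q) * (e / (1 - q)).
  by rewrite mulrC divfK // gt_eqF // subr_gt0.
have B1 : c * B0 + 0 * B0 + 1 <= B.
  by rewrite /B mul0r addr0 lerDl divr_ge0 // subr_ge0 ltW.
have B2 : q * B + e <= B.
  have : 0 <= (1 - q) * (c * B0 + 1).
    by apply: mulr_ge0; [rewrite subr_ge0 ltW|exact: addr_ge0].
  by rewrite /B; move: (e / _) eB => u ->; nra.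
exists B; elim=> [|b IH] /=.
  apply: (@le_trans _ _ (c * B0 + 0 * B0 + 1)%:E); last by rewrite lee_fin.
  by apply: integral_lin_le => //; exact: measurable_abs_powR.
apply: (@le_trans _ _ (q * B
  + c * 2 `^ alpha * (A `^ alpha * m%:R `^ alpha) * (m%:R * C)
  + c * 2 `^ alpha)%:E).
  by apply: integral_lin_le.
by rewrite lee_fin -addrA.
Qed.

Local Notation x w := (path_state M p N a K (X0 w) (Z^~ w)).

Let block_noise_powR w b :
  block_noise p (Z^~ w) b `^ alpha <= m%:R `^ alpha * noise_pow b w.
Proof.
exact: (powR_sum_le alpha (fun i => `|Z (b * m + i) w|)).
Qed.

(** Induction over blocks on a fixed sample path: [lyap_init] starts it, [lyap_path] advances it,
    and the block noise is traded for [noise_pow]. *)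
Lemma lyap_le_majorant w b (y := fun b => x w (b * m)) :
  lyap alpha beta K (y b) (scale K y b) <= majorant b w.
Proof.
elim: b => [|b IH].
  rewrite /= mul0r addr0 addrC.
  by apply: (lyap_init alpha beta A K).
apply: (le_trans (lyap_path M p N a K symbols a_ge1 K_ge1 N_large (X0 w)
  (Z^~ w) alpha beta b beta_gt0 beta_alpha K_large)).
rewrite /= -addrA; apply: lerD; first by rewrite ler_wpM2l.
rewrite [leLHS]mulrDr mulr1 [leLHS]addrC lerD2r -[leRHS]mulrA ler_wpM2l //.
by rewrite powRM ?block_noise_ge0 // -[leRHS]mulrA ler_wpM2l ?powR_ge0.
Qed.

(** Within a block the state grows by at most the factor [A] applied to the block start plus the
    noise. The first is controlled by [norm_powR_le_lyap], the second by comparing its [beta]-th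
    power with 1 plus its [alpha]-th. *)
Lemma norm_state_le_majorant w b r : (r <= p)%N ->
  `|x w (b * m + r)| `^ beta <=
  (2 * A) `^ beta * majorant b w
  + (2 * A) `^ beta * m%:R `^ alpha * noise_pow b w + (2 * A) `^ beta.
Proof.
move=> rp; have b0 := ltW beta_gt0.
have S0 := block_noise_ge0 p (Z^~ w) b.
have h := norm_path_le M p N a K symbols a_ge1 K_ge1 N_large (X0 w) (Z^~ w)
  b r rp.
set y := fun b => x w (b * m).
have D1 : 1 <= scale K y b by exact: scale_ge1.
have yW : `|y b| `^ beta <= majorant b w.
  apply: le_trans (lyap_le_majorant w b).
  by apply: (norm_powR_le_lyap alpha beta A K).
have SW : block_noise p (Z^~ w) b `^ beta <= 1 + m%:R `^ alpha * noise_pow b w.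
  apply: (@le_trans _ _ (1 + block_noise p (Z^~ w) b `^ alpha)).
    by apply: powR_le_1D => //; exact: ltW.
  by rewrite lerD2l.
apply: (@le_trans _ _ ((A * (`|y b| + block_noise p (Z^~ w) b)) `^ beta)).
  by apply: le_powR_l.
rewrite powRM ?addr_ge0 // [X in _ <= X + _ + _]mulrC powRM //.
apply: (@le_trans _ _ (A `^ beta * (2 `^ beta *
   (`|y b| `^ beta + block_noise p (Z^~ w) b `^ beta)))).
  by rewrite ler_wpM2l ?powR_ge0 // powR_add_le.
have Ab := powR_ge0 A beta; have tb := powR_ge0 (2 : R) beta.
apply: (@le_trans _ _ (A `^ beta * (2 `^ beta *
   (majorant b w + (1 + m%:R `^ alpha * noise_pow b w))))).
  by rewrite !ler_wpM2l // lerD.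
by rewrite le_eqVlt; apply/orP; left; apply/eqP; ring.
Qed.

Lemma state_moment_bounded :
  exists B : R, forall n,
    (\int[P]_w (`|state (encoder M p N K) (controller M p N a K) a X0 Z n w|
       `^ beta)%:E <= B%:E)%E.
Proof.
have [B majB] := majorant_moment.
exists ((2 * A) `^ beta * B + (2 * A) `^ beta * m%:R `^ alpha * (m%:R * C)
  + (2 * A) `^ beta) => n.
pose b := (n %/ m)%N.
have cA := powR_ge0 (2 * A) beta.
have cm : 0 <= (2 * A) `^ beta * m%:R `^ alpha by rewrite mulr_ge0 ?powR_ge0.
apply: le_trans (integral_lin_le P (majorant b) (noise_pow b) _ _ _ _ _
  (measurable_majorant b) (measurable_noise_pow b) (majorant_ge0 b)
  (noise_pow_ge0 b) cA cm cA (majB b) (noise_pow_moment b)).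
apply: ge0_le_integral_nonmeasurable => w; rewrite lee_fin ?powR_ge0 //.
rewrite -[state _ _ _ _ _ _ _]/(x w n) (divn_eq n m).
by apply: norm_state_le_majorant; rewrite -ltnS ltn_mod.
Qed.

End MomentBound.

Theorem theorem1 (R : realType) (d : measure_display) (T : measurableType d)
  (P : probability T R) (a alpha : R) (X0 : T -> R) (Z : nat -> T -> R) :
  1 <= a -> 0 < alpha ->
  measurable_fun setT X0 -> (forall n, measurable_fun setT (Z n)) ->
  mutually_independent P (fun j => match j with 0 => X0 | k.+1 => Z k end) ->
  (\int[P]_w ((`|X0 w| `^ alpha)%:E) < +oo)%E ->
  (exists C : R, forall n, (\int[P]_w ((`|Z n w| `^ alpha)%:E) <= C%:E)%E) ->
  forall beta : R, 0 < beta -> beta < alpha ->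
  exists (M : nat) (f : forall k : nat, ('I_k.+1 -> R) -> 'I_M)
         (g : forall k : nat, ('I_k.+1 -> 'I_M) -> R),
    (M%:Z <= Num.floor a + 1)%R /\
    (forall k, Rn_measurable_quant (f k)) /\
    moment_stable P beta (state f g a X0 Z).
Proof.
move=> a1 _ mX0 mZ _ X0fin [C ZC] beta b0 ba.
have a0 : 0 <= a := le_trans ler01 a1.
(* The number of bins is [(Num.truncn a).+1], which strictly exceeds [a] and equals [floor a + 1]
   since [a >= 0]. *)
have [p [N [symbols N_large]]] :=
  block_length_exists a (Num.truncn a) a1 (truncnS_gt a).
have [K K1 K_large] :=
  zoom_factor_exists alpha beta (a ^+ p.+1) b0 ba (exprn_ege1 _ a1).
have X0B : (\int[P]_w (`|X0 w| `^ alpha)%:E <=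
            (fine (\int[P]_w (`|X0 w| `^ alpha)%:E))%:E)%E.
  rewrite fineK // ge0_fin_numE //.
  by apply: integral_ge0 => w _; rewrite lee_fin powR_ge0.
exists (Num.truncn a).+1, (encoder (Num.truncn a) p N K),
  (controller (Num.truncn a) p N a K); split; last split.
- by rewrite -addn1 PoszD lerD2r truncn_floor a0 gez0_abs ?floor_ge0.
- by move=> k; exact: encoder_measurable.
- have [B stateB] := state_moment_bounded P _ p N a K alpha beta X0 Z _ C
    symbols a1 K1 N_large b0 ba K_large mX0 mZ X0B ZC.
  exact: limn_esup_lty stateB.
Qed.
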